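(* Let $f$ be a bounded arithmetical function, say $|f(m)|\le B$ for all $m\in\mathbb{N}$, supported on a set of positive integers having at least two distinct prime divisors, and let $L(s,f)=\sum_{m\ge1}f(m)m^{-s}$ for $\operatorname{Re}s>1$. Let $t_1,t_2\in\mathbb{R}$, $\delta_1,\delta_2>0$, and let $\sigma:\mathbb{N}\to\mathbb{N}$ be a bijection. Let $s\in\mathbb{C}$ with $\operatorname{Re}s>1$ and assume $$L(s+i(t_1+\delta_1 n),f)=L(s+i(t_2+\delta_2\sigma(n)),f)\qquad\text{for } n=1,2,\ldots.$$ Then either $t_1=t_2$, $\delta_1=\delta_2$ and $\sigma=\mathrm{id}$, or $\operatorname{Re}s\le b$, where $b$ is the constant defined below (depending only on $f,t_j,\delta_j,\sigma$).
   Context: For $n,m\in\mathbb{N}$ put $\phi_n(m)=f(m)\big(m^{-i(t_1+\delta_1 n)}-m^{-i(t_2+\delta_2\sigma(n))}\big)$. For each $n$ such that $\phi_n(m)\neq0$ for some $m$, let $\mu_n=\min\{m\in\mathbb{N}:\phi_n(m)\neq0\}$ and $b_n=1+\frac{2B\mu_n}{|\phi_n(\mu_n)|}$. Then $b:=\inf\{b_n:n\in\mathbb{N},\ \phi_n(m)\neq0\text{ for some }m\}$ (with $\inf\emptyset=+\infty$). *)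

(* Defs.v *)
From Stdlib Require Import Reals ZArith Znumtheory.
From Coquelicot Require Import Coquelicot.

Open Scope R_scope.

(* Throughout, an arithmetical function is represented by some f : nat -> C
   whose value at 0 is never used; the positive integers are the n with
   (1 <= n)%nat. *)

Definition Cexp (z : C) : C :=
  (exp (Re z) * cos (Im z), exp (Re z) * sin (Im z)).

(* m^z = exp (z log m); meant for m >= 1. *)
Definition ncpow (m : nat) (z : C) : C := Cexp (z * RtoC (ln (INR m)))%C.

(* Sum of a complex series; as with Coquelicot's other total operators, the
   value is meaningful only when the series converges. *)
Definition CSeries (a : nat -> C) : C :=
  @iota (CompleteNormedModule.CompleteSpace C_AbsRing C_CompleteNormedModule)
    (@is_series C_AbsRing C_NormedModule a).

Lemma CSeries_unique (a : nat -> C) (l : C) :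
  @is_series C_AbsRing C_NormedModule a l -> CSeries a = l.
Proof.
  intro H.
  exact (@iota_filterlim_locally C_AbsRing C_CompleteNormedModule
           nat eventually _ (@sum_n C_NormedModule a) l H).
Qed.

(* The index k stands for m = k + 1. *)
Definition Lfun (s : C) (f : nat -> C) : C :=
  CSeries (fun k => (f (S k) * ncpow (S k) (- s))%C).

Definition has_prime_divisor_in_support (f : nat -> C) (p : Z) : Prop :=
  exists m : nat, (1 <= m)%nat /\ f m <> RtoC 0 /\ (p | Z.of_nat m)%Z.

(* "At least two distinct prime divisors" is a property of the support as a
   set: two distinct primes each divide some element of it. *)
Definition support_has_two_primes (f : nat -> C) : Prop :=
  exists p q : Z, prime p /\ prime q /\ p <> q /\
    has_prime_divisor_in_support f p /\ has_prime_divisor_in_support f q.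

Definition bijective_on_positive (sigma : nat -> nat) : Prop :=
  (forall n, (1 <= n)%nat -> (1 <= sigma n)%nat) /\
  (forall n n', (1 <= n)%nat -> (1 <= n')%nat -> sigma n = sigma n' -> n = n') /\
  (forall k, (1 <= k)%nat -> exists n, (1 <= n)%nat /\ sigma n = k).

Definition phi (f : nat -> C) (t1 t2 delta1 delta2 : R) (sigma : nat -> nat)
    (n m : nat) : C :=
  (f m * (ncpow m (- (Ci * RtoC (t1 + delta1 * INR n)))
          - ncpow m (- (Ci * RtoC (t2 + delta2 * INR (sigma n))))))%C.

Definition is_min_nonzero (g : nat -> C) (mu : nat) : Prop :=
  (1 <= mu)%nat /\ g mu <> RtoC 0 /\
  forall m : nat, (1 <= m)%nat -> g m <> RtoC 0 -> (mu <= m)%nat.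

(* A minimal mu exists exactly for those n with phi_n not identically 0, and is
   then unique, so the set below is { b_n : phi_n is not identically 0 };
   Glb_Rbar of the empty set is p_infty. *)
Definition bconst (f : nat -> C) (B t1 t2 delta1 delta2 : R)
    (sigma : nat -> nat) : Rbar :=
  Glb_Rbar (fun x : R => exists n mu : nat, (1 <= n)%nat /\
    is_min_nonzero (phi f t1 t2 delta1 delta2 sigma n) mu /\
    x = 1 + 2 * B * INR mu / Cmod (phi f t1 t2 delta1 delta2 sigma n mu)).

(* Main.v *)
Require Import Defs.
From Stdlib Require Import Reals ZArith Znumtheory Lra Lia.
From Coquelicot Require Import Coquelicot.
Open Scope R_scope.

(** If [phi_n] is not identically zero and [mu] is its first nonzero index,
    the hypothesis for [n] says that the Dirichlet series of [phi_n] vanishes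
    at [s], so its leading term is at most the sum of the others in modulus.
    With [r = Re s], comparing with an integral gives
    [|phi_n(mu)| mu^(-r) <= 2 B mu^(1-r) / (r-1)], that is [r <= b_n].  When
    every [phi_n] vanishes identically, [b] is infinite. *)

(** Apply [1 + u <= exp u] at [u = ln (m / (m + 1))], where [exp u = 1 - 1 / (m + 1)]. *)
Lemma ln_sub_pred_ge (m : nat) :
  (1 <= m)%nat -> / INR (S m) <= ln (INR (S m)) - ln (INR m).
Proof.
  intro Hm.
  assert (H1 : 0 < INR m) by (apply lt_0_INR; lia).
  rewrite S_INR.
  set (x := INR m) in *.
  assert (Hu : 0 < x / (x + 1)) by (apply Rdiv_lt_0_compat; lra).
  pose proof (exp_ineq1_le (ln (x / (x + 1)))) as H.
  rewrite exp_ln in H by exact Hu.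
  rewrite ln_div in H by lra.
  assert (E : x / (x + 1) = 1 - / (x + 1)) by (field; lra).
  lra.
Qed.

(** The right side is the integral of the decreasing function [x^(-1-c)] over [[m, m+1]]. The proof
    avoids integration: [m^(-c)] is [(m+1)^(-c)] times [exp (c (ln (m+1) - ln m))], and that factor
    is at least [1 + c / (m+1)]. *)
Lemma exp_ln_telescope (c : R) (m : nat) :
  0 < c -> (1 <= m)%nat ->
  exp (- (1 + c) * ln (INR (S m)))
  <= exp (- c * ln (INR m)) / c - exp (- c * ln (INR (S m))) / c.
Proof.
  intros Hc Hm.
  pose proof (ln_sub_pred_ge m Hm) as Hln.
  assert (H1 : 0 < INR (S m)) by (apply lt_0_INR; lia).
  set (y := ln (INR (S m))) in *.
  set (z := ln (INR m)) in *.
  assert (E1 : exp (- (1 + c) * y) = exp (- c * y) * / INR (S m)).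
  { replace (- (1 + c) * y) with (- c * y + - y) by ring.
    rewrite exp_plus, (exp_Ropp y).
    unfold y; rewrite exp_ln by exact H1; reflexivity. }
  assert (E2 : exp (- c * z) = exp (- c * y) * exp (c * (y - z))).
  { rewrite <- exp_plus; f_equal; ring. }
  rewrite E1, E2.
  replace (_ / c - _ / c)
    with ((exp (- c * y) * exp (c * (y - z)) - exp (- c * y)) / c) by (field; lra).
  apply (proj1 (Rle_div_r _ _ _ Hc)).
  pose proof (exp_ineq1_le (c * (y - z))) as H.
  pose proof (exp_pos (- c * y)) as Hp.
  assert (H2 : c * / INR (S m) <= c * (y - z)) by (apply Rmult_le_compat_l; lra).
  assert (H3 : c * / INR (S m) <= exp (c * (y - z)) - 1) by lra.
  apply (Rmult_le_compat_l (exp (- c * y))) in H3; lra.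
Qed.

(** The terms are positive, and telescoping the previous bound keeps the partial sums below
    [a O + g 1]. *)
Lemma ex_series_exp_ln (c : R) :
  0 < c -> ex_series (fun k => exp (- (1 + c) * ln (INR (S k)))).
Proof.
  intro Hc.
  set (a := fun k => exp (- (1 + c) * ln (INR (S k)))).
  set (g := fun m => exp (- c * ln (INR m)) / c).
  assert (Hg : forall m, 0 < g m)
    by (intro m; apply Rdiv_lt_0_compat; [apply exp_pos | exact Hc]).
  assert (Hb : forall N, sum_n a N <= a O + g 1%nat - g (S N)).
  { induction N as [|N IH].
    - rewrite sum_O; lra.
    - rewrite sum_Sn; change plus with Rplus.
      pose proof (exp_ln_telescope c (S N) Hc ltac:(lia)) as H.
      change (a (S N) <= g (S N) - g (S (S N))) in H.
      lra. }
  destruct (ex_finite_lim_seq_incr (sum_n a) (a O + g 1%nat)) as [l Hl].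
  - intro N; rewrite sum_Sn; change plus with Rplus.
    assert (0 < a (S N)) by apply exp_pos; lra.
  - intro N; pose proof (Hb N); pose proof (Hg (S N)); lra.
  - exists l; exact Hl.
Qed.

Lemma Cmod_Cexp (z : C) : Cmod (Cexp z) = exp (Re z).
Proof.
  destruct z as [x y]; unfold Cexp, Cmod; simpl.
  (* The fifth [exp x] is the right-hand side; as the root of a square, it leaves only the radicands
     to compare. *)
  rewrite <- (sqrt_Rsqr (exp x)) at 5 by apply Rlt_le, exp_pos.
  f_equal; pose proof (sin2_cos2 y) as H; unfold Rsqr in *.
  replace (exp x * exp x)
    with (exp x * exp x * (sin y * sin y + cos y * cos y))
    by (rewrite H; ring).
  ring.
Qed.

Lemma Cexp_plus (z w : C) : Cexp (z + w) = (Cexp z * Cexp w)%C.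
Proof.
  destruct z, w; unfold Cexp, Cmult; simpl.
  rewrite exp_plus, cos_plus, sin_plus.
  f_equal; ring.
Qed.

Lemma ncpow_plus (m : nat) (z w : C) :
  ncpow m (z + w) = (ncpow m z * ncpow m w)%C.
Proof.
  unfold ncpow; rewrite <- Cexp_plus; f_equal; ring.
Qed.

Lemma Cmod_ncpow (m : nat) (z : C) :
  Cmod (ncpow m z) = exp (Re z * ln (INR m)).
Proof.
  unfold ncpow; rewrite Cmod_Cexp; f_equal; unfold Re; simpl; ring.
Qed.

(** Absolute convergence, by comparison with [B m^(-Re s)], makes [Lfun] the genuine sum of its
    series. *)
Lemma is_series_Lfun (f : nat -> C) (B : R) (s : C) :
  (forall m : nat, (1 <= m)%nat -> Cmod (f m) <= B) -> 1 < Re s ->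
  @is_series C_AbsRing C_NormedModule
    (fun k => (f (S k) * ncpow (S k) (- s))%C) (Lfun s f).
Proof.
  intros hB hs.
  destruct (@ex_series_le C_AbsRing C_CompleteNormedModule
    (fun k => (f (S k) * ncpow (S k) (- s))%C)
    (fun k => B * exp (- (1 + (Re s - 1)) * ln (INR (S k))))) as [l Hl].
  - intro k; change norm with Cmod.
    rewrite Cmod_mult, Cmod_ncpow.
    replace (- (1 + (Re s - 1))) with (Re (- s)) by (unfold Re; simpl; ring).
    apply Rmult_le_compat_r; [apply Rlt_le, exp_pos | apply hB; lia].
  - apply (@ex_series_scal_l R_AbsRing R_NormedModule B), ex_series_exp_ln; lra.
  - unfold Lfun; rewrite (CSeries_unique _ _ Hl); exact Hl.
Qed.

(** Since the sum is zero, [d k0] is minus the tail after it, and the tail is at most the integral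
    of [M x^(-1-c)] from [k0 + 1] to infinity. *)
Lemma leading_term_le (d : nat -> C) (k0 : nat) (M c : R) :
  0 < c -> 0 <= M ->
  @is_series C_AbsRing C_NormedModule d (RtoC 0) ->
  (forall k, (k < k0)%nat -> d k = RtoC 0) ->
  (forall k, Cmod (d k) <= M * exp (- (1 + c) * ln (INR (S k)))) ->
  Cmod (d k0) <= M * (exp (- c * ln (INR (S k0))) / c).
Proof.
  intros Hc HM Hd Hz Hle.
  set (g := fun m => exp (- c * ln (INR m)) / c).
  assert (Hg : forall m, 0 < g m)
    by (intro m; apply Rdiv_lt_0_compat; [apply exp_pos | exact Hc]).
  pose (S_ := @sum_n C_NormedModule d : nat -> C).
  assert (H0 : S_ k0 = d k0).
  { assert (Hk : forall k, (k < k0)%nat -> S_ k = RtoC 0).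
    { induction k as [|k IH]; intro Hk; unfold S_ in *.
      - rewrite sum_O; apply Hz; exact Hk.
      - rewrite sum_Sn, IH, (Hz (S k)) by lia; apply Cplus_0_l. }
    destruct k0 as [|k]; unfold S_ in *.
    - apply sum_O.
    - rewrite sum_Sn, Hk by lia; apply Cplus_0_l. }
  (* The finite tail after [k0], bounded by telescoping. *)
  assert (Hb : forall N, Cmod (S_ (N + k0)%nat - d k0)%C
                         <= M * (g (S k0) - g (S (N + k0)))).
  { induction N as [|N IH].
    - simpl; rewrite H0.
      replace (d k0 - d k0)%C with (RtoC 0) by ring.
      rewrite Cmod_0; right; ring.
    - pose proof (exp_ln_telescope c (S (N + k0)) Hc ltac:(lia)) as H.
      change (exp (- (1 + c) * ln (INR (S (S (N + k0)))))
              <= g (S (N + k0)) - g (S (S (N + k0)))) in H.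
      apply (Rmult_le_compat_l M) in H; [|exact HM].
      pose proof (Hle (S (N + k0))) as H1.
      replace (S_ (S N + k0)%nat) with (S_ (N + k0)%nat + d (S (N + k0)))%C
        by (unfold S_; simpl; rewrite sum_Sn; reflexivity).
      replace (S_ (N + k0)%nat + d (S (N + k0)) - d k0)%C
        with ((S_ (N + k0)%nat - d k0) + d (S (N + k0)))%C by ring.
      pose proof (Cmod_triangle (S_ (N + k0)%nat - d k0) (d (S (N + k0)))) as H2.
      simpl Nat.add; lra. }
  (* For large [N] the partial sum is smaller than [eps], so [d k0] exceeds the tail bound by at
     most [eps]. *)
  apply le_epsilon; intros eps Heps.
  destruct (proj1 (@filterlim_locally_ball_norm C_AbsRing nat C_NormedModule
    eventually _ S_ (RtoC 0)) Hd (mkposreal eps Heps)) as [N HN].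
  specialize (HN (N + k0)%nat ltac:(lia)).
  unfold ball_norm in HN; simpl in HN.
  change (Cmod (S_ (N + k0)%nat - 0)%C < eps) in HN.
  replace (S_ (N + k0)%nat - 0)%C with (S_ (N + k0)%nat) in HN by ring.
  specialize (Hb N).
  pose proof (Cmod_triangle (S_ (N + k0)%nat) (- (S_ (N + k0)%nat - d k0))) as H2.
  rewrite Cmod_opp in H2.
  replace (S_ (N + k0)%nat + - (S_ (N + k0)%nat - d k0))%C with (d k0) in H2 by ring.
  pose proof (Rmult_le_pos M (g (S (N + k0))) HM (Rlt_le _ _ (Hg _))).
  change (exp (- c * ln (INR (S k0))) / c) with (g (S k0)).
  lra.
Qed.

(** Purely imaginary exponents give powers of modulus 1. *)
Lemma Cmod_phi_le (f : nat -> C) (t1 t2 delta1 delta2 : R)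
    (sigma : nat -> nat) (n m : nat) :
  Cmod (phi f t1 t2 delta1 delta2 sigma n m) <= 2 * Cmod (f m).
Proof.
  assert (H : forall u : R, Cmod (ncpow m (- (Ci * RtoC u))) = 1).
  { intro u; rewrite Cmod_ncpow, <- exp_0; f_equal; unfold Re; simpl; ring. }
  unfold phi; rewrite Cmod_mult, Rmult_comm.
  apply Rmult_le_compat_r; [apply Cmod_ge_0|].
  eapply Rle_trans; [apply Cmod_triangle|].
  rewrite Cmod_opp, !H; lra.
Qed.

Theorem theorem4 (f : nat -> C) (B : R)
    (hB : forall m : nat, (1 <= m)%nat -> Cmod (f m) <= B)
    (hsupp : support_has_two_primes f)
    (t1 t2 delta1 delta2 : R) (hdelta1 : 0 < delta1) (hdelta2 : 0 < delta2)
    (sigma : nat -> nat) (hsigma : bijective_on_positive sigma)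
    (s : C) (hs : 1 < Re s)
    (hL : forall n : nat, (1 <= n)%nat ->
       Lfun (s + Ci * RtoC (t1 + delta1 * INR n))%C f
       = Lfun (s + Ci * RtoC (t2 + delta2 * INR (sigma n)))%C f) :
  (t1 = t2 /\ delta1 = delta2 /\ forall n : nat, (1 <= n)%nat -> sigma n = n)
  \/ Rbar_le (Finite (Re s)) (bconst f B t1 t2 delta1 delta2 sigma).
Proof.
  right.
  (* As [b] is a greatest lower bound, it suffices that [Re s] lies below every [b_n]. *)
  apply (proj2 (Glb_Rbar_correct _)).
  intros x (n & mu & Hn & (Hmu & Hnz & Hmin) & ->); simpl.
  set (ph := phi f t1 t2 delta1 delta2 sigma n) in *.
  set (d := fun k => (ph (S k) * ncpow (S k) (- s))%C).
  assert (Hd : @is_series C_AbsRing C_NormedModule d (RtoC 0)).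
  { assert (Hre : forall u : R, 1 < Re (s + Ci * RtoC u)%C)
      by (intro u; unfold Re in *; simpl; lra).
    pose proof (is_series_Lfun f B _ hB (Hre (t1 + delta1 * INR n))) as S1.
    pose proof (is_series_Lfun f B _ hB (Hre (t2 + delta2 * INR (sigma n)))) as S2.
    rewrite <- (hL n Hn) in S2.
    pose proof (is_series_minus _ _ _ _ S1 S2) as S3.
    (* By [hL] both series have the same sum; zero is written as that sum minus itself to fit
       [S3]. *)
    replace (RtoC 0) with
      (@plus C_NormedModule (Lfun (s + Ci * RtoC (t1 + delta1 * INR n))%C f)
        (opp (Lfun (s + Ci * RtoC (t1 + delta1 * INR n))%C f)))
      by apply (@plus_opp_r C_NormedModule).
    refine (is_series_ext _ _ _ _ S3).
    intro k; unfold d, ph, phi.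
    change plus with Cplus; change opp with Copp.
    change (@eq _ ?a ?b) with (@eq C a b).
    (* Splitting [m^(-s-iu)] as [m^(-s) m^(-iu)] makes [m^(-s)] a common factor, and [phi]
       remains. *)
    rewrite !Copp_plus_distr, !ncpow_plus; ring. }
  assert (HB0 : 0 <= B)
    by (eapply Rle_trans; [apply Cmod_ge_0 | apply (hB 1%nat); lia]).
  (* Index [k] stands for [m = k + 1], so the leading term sits at [mu - 1]. *)
  assert (Hz : forall k, (k < mu - 1)%nat -> d k = RtoC 0).
  { intros k Hk; unfold d.
    destruct (Ceq_dec (ph (S k)) (RtoC 0)) as [E|E].
    - rewrite E; ring.
    - specialize (Hmin (S k) ltac:(lia) E); lia. }
  assert (Hmod : forall k, Cmod (d k)
            = Cmod (ph (S k)) * exp (- (1 + (Re s - 1)) * ln (INR (S k)))).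
  { intro k; unfold d; rewrite Cmod_mult, Cmod_ncpow.
    do 3 f_equal; unfold Re; simpl; ring. }
  assert (Hle : forall k, Cmod (d k)
            <= 2 * B * exp (- (1 + (Re s - 1)) * ln (INR (S k)))).
  { intro k; rewrite Hmod.
    apply Rmult_le_compat_r; [apply Rlt_le, exp_pos|].
    eapply Rle_trans; [apply Cmod_phi_le|].
    pose proof (hB (S k) ltac:(lia)); lra. }
  pose proof (leading_term_le d (mu - 1) (2 * B) (Re s - 1)
                ltac:(lra) ltac:(lra) Hd Hz Hle) as H.
  rewrite Hmod in H.
  replace (S (mu - 1)) with mu in H by lia.
  assert (Hm0 : 0 < INR mu) by (apply lt_0_INR; lia).
  assert (Hp : 0 < Cmod (ph mu)) by (apply Cmod_gt_0; exact Hnz).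
  set (c := Re s - 1) in *.
  assert (Hc : 0 < c) by (unfold c; lra).
  (* Writing [mu^(-c) = mu^(-1-c) mu] exposes the factor [e = mu^(-1-c)] on both sides of [H]. *)
  assert (E : exp (- c * ln (INR mu)) = exp (- (1 + c) * ln (INR mu)) * INR mu).
  { rewrite <- (exp_ln (INR mu)) at 3 by exact Hm0.
    rewrite <- exp_plus; f_equal; ring. }
  rewrite E in H.
  set (e := exp (- (1 + c) * ln (INR mu))) in *.
  assert (He : 0 < e) by apply exp_pos.
  enough (c <= 2 * B * INR mu / Cmod (ph mu)) by (unfold c in *; lra).
  apply (proj1 (Rle_div_r _ _ _ Hp)).
  (* Multiplying by the positive [e / c] turns the goal back into [H]. *)
  apply (Rmult_le_reg_r (e / c)); [apply Rdiv_lt_0_compat; assumption|].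
  replace (c * Cmod (ph mu) * (e / c)) with (Cmod (ph mu) * e) by (field; lra).
  replace (2 * B * INR mu * (e / c)) with (2 * B * (e * INR mu / c)) by (field; lra).
  exact H.
Qed.
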